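(* Let $J$ be an interval with left endpoint $0\in J$, let $\mathcal{T}:J\to\mathbb{R}^{2\times2}$ be symmetric-matrix valued and of class $C^k$ with $k\ge 2$, and let $\mathcal{D}$ solve $\ddot{\mathcal{D}}=\mathcal{T}\mathcal{D}$, $\mathcal{D}(0)=0$, $\dot{\mathcal{D}}(0)=I$. Let $\lambda_c>0$ be an interior point of $J$ which is a focus, i.e. $\mathcal{D}(\lambda_c)=0$. Put $\epsilon=\lambda-\lambda_c$, $\mathcal{R}_c=\mathcal{R}(\lambda_c)$, $\mathcal{F}_c=\mathcal{F}(\lambda_c)$, $\dot{\mathcal{D}}_c=\dot{\mathcal{D}}(\lambda_c)$. Then $\det\dot{\mathcal{D}}_c\ne0$, and as $\epsilon\to0$: $$\det\mathcal{D}=\epsilon^2\Big[1+\tfrac{\epsilon^2}{3}\mathcal{R}_c\Big]\det\dot{\mathcal{D}}_c+O(\epsilon^5),$$ $$\theta=\frac1\epsilon\Big[1+\tfrac13\mathcal{R}_c\epsilon^2\Big]+O(\epsilon^2),\qquad \sigma=\tfrac13\mathcal{F}_c\,\epsilon+O(\epsilon^2),$$ $$w=\operatorname{sign}(\det\dot{\mathcal{D}}_c)\,|\epsilon|\sqrt{|\det\dot{\mathcal{D}}_c|}\,\big(1+O(\epsilon^2)\big).$$ In particular $w$ is continuous at $\lambda_c$, its sign is the same on both sides of $\lambda_c$, and $\dot w$ has a finite jump discontinuity at $\lambda_c$. The same expansions of $\theta$ and $\sigma$ hold at the vertex $\lambda_c=0$ as $\epsilon\searrow0$ (with $\mathcal{R}_c,\mathcal{F}_c$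 replaced by $\mathcal{R}(0),\mathcal{F}(0)$).
   Context: Dots denote $d/d\lambda$. The symmetric matrix $\mathcal{T}$ is parametrized by a real function $\mathcal{R}$ (source of convergence) and a complex function $\mathcal{F}$ (source of shear): $$\mathcal{T}=\begin{pmatrix}\mathcal{R}-\operatorname{Re}\mathcal{F}&\operatorname{Im}\mathcal{F}\\ \operatorname{Im}\mathcal{F}&\mathcal{R}+\operatorname{Re}\mathcal{F}\end{pmatrix}.$$ Wherever $\mathcal{D}(\lambda)$ is invertible, the optical deformation matrix is $\mathcal{S}=\dot{\mathcal{D}}\mathcal{D}^{-1}$, which is symmetric, and the optical scalars $\theta\in\mathbb{R}$ (rate of expansion), $\sigma\in\mathbb{C}$ (rate of shear) are defined by $$\mathcal{S}=\begin{pmatrix}\theta-\operatorname{Re}\sigma&\operatorname{Im}\sigma\\ \operatorname{Im}\sigma&\theta+\operatorname{Re}\sigma\end{pmatrix}.$$ Further $w(\lambda)=\operatorname{sign}(\det\mathcal{D}(\lambda))\sqrt{|\det\mathcal{D}(\lambda)|}$. *)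

(* Defs.v *)
From HB Require Import structures.
From mathcomp Require Import all_boot all_order all_algebra.
From mathcomp Require Import all_classical all_reals all_analysis.
From mathcomp Require Import complex ring lra.

Set Implicit Arguments.
Unset Strict Implicit.
Unset Printing Implicit Defensive.

Import Order.TTheory GRing.Theory Num.Theory.
Import numFieldNormedType.Exports.

Local Open Scope classical_set_scope.
Local Open Scope ring_scope.

(* Limit of the difference quotient along J: the two-sided derivative at
   interior points of J, the one-sided one at an endpoint belonging to J. *)
Definition has_derivative_in (R : realType) (V : normedModType R)
    (J : set R) (f : R -> V) (x : R) (l : V) : Prop :=
  (fun y => (y - x)^-1 *: (f y - f x)) @ within J x^' --> l.

(* g i is the i-th derivative of f; only the values of f on J matter. *)
Definition class_C (R : realType) (V : normedModType R)
    (k : nat) (J : set R) (f : R -> V) : Prop :=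
  exists g : nat -> R -> V,
    [/\ forall x, J x -> g 0%N x = f x,
        forall i x, (i < k)%N -> J x -> has_derivative_in J (g i) x (g i.+1 x)
      & {within J, continuous (g k)}].

Definition optical_mx (R : realType) (r : R) (z : R[i]) : 'M[R]_2 :=
  \matrix_(i, j)
    (if i == j then (if i == 0 then r - complex.Re z else r + complex.Re z)
     else complex.Im z).

(* The real and the complex parameter of a symmetric matrix written in the form
   optical_mx; they are total, and meaningful for symmetric matrices
   (see optical_mxK). *)
Definition scalar_part (R : realType) (A : 'M[R]_2) : R := (A 0 0 + A 1 1) / 2.

Definition shear_part (R : realType) (A : 'M[R]_2) : R[i] :=
  Complex ((A 1 1 - A 0 0) / 2) (A 0 1).

Lemma optical_mxK (R : realType) (A : 'M[R]_2) :
  A^T = A -> optical_mx (scalar_part A) (shear_part A) = A.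
Proof.
move=> symA; apply/matrixP => i j; rewrite mxE /scalar_part /shear_part /=.
have A10 : A 1 0 = A 0 1 by rewrite -[in LHS]symA mxE.
have i01 (k : 'I_2) : k = 0 \/ k = 1.
  by case: k => [[|[|//]] ?]; [left|right]; apply/val_inj.
case: (i01 i) => ->; case: (i01 j) => -> //=.
  lra.
lra.
Qed.

Lemma optical_mx_scalar (R : realType) (r : R) (z : R[i]) :
  scalar_part (optical_mx r z) = r.
Proof.
by rewrite /scalar_part !mxE /=; lra.
Qed.

Lemma optical_mx_shear (R : realType) (r : R) (z : R[i]) :
  shear_part (optical_mx r z) = z.
Proof.
by case: z => a b; rewrite /shear_part !mxE /=; congr Complex; lra.
Qed.

(* D' stands for the derivative of D.  invmx is the identity on singular
   matrices, so the value is meaningful only where D x is invertible. *)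
Definition deformation (R : realType) (D D' : R -> 'M[R]_2) (x : R) : 'M[R]_2 :=
  D' x *m invmx (D x).

Definition theta (R : realType) (D D' : R -> 'M[R]_2) (x : R) : R :=
  scalar_part (deformation D D' x).

Definition sigma (R : realType) (D D' : R -> 'M[R]_2) (x : R) : R[i] :=
  shear_part (deformation D D' x).

Definition wdet (R : realType) (D : R -> 'M[R]_2) (x : R) : R :=
  Num.sg (\det (D x)) * Num.sqrt `|\det (D x)|.

(* Modulus with values in R (the norm of R[i] takes its values in R[i]). *)
Definition cmod (R : realType) (z : R[i]) : R := ComplexField.Normc.normc z.

(* Main.v *)
(* Near a zero c of D write e = x - c and P = D'(c).  Starting from D = O(e), the
   equation D'' = T D and T = T(c) + O(e) are integrated repeatedly by the mean
   value theorem, giving D' = P + e^2/2 T(c) P + O(e^3) and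
   D = e P + e^3/6 T(c) P + O(e^4).  Hence e D' - D - e^2/3 T(c) D = O(e^4), and
   multiplying by the adjugate of D and dividing by e det D, of exact order e^3,
   gives D' D^-1 = e^-1 + e/3 T(c) + O(e^2).  The symmetry of D' D^-1 is the
   vanishing of the Wronskian D^T D' - D'^T D.  If det P = 0, a vector v in
   ker P would give a solution D v with zero Cauchy data at c, which Gronwall's
   inequality forbids since D'(0) v = v. *)

Require Import Defs.
From HB Require Import structures.
From mathcomp Require Import all_boot all_order all_algebra.
From mathcomp Require Import all_classical all_reals all_analysis.
From mathcomp Require Import complex ring lra.

Set Implicit Arguments.
Unset Strict Implicit.
Unset Printing Implicit Defensive.

Import Order.TTheory GRing.Theory Num.Theory.
Import numFieldNormedType.Exports.

Local Open Scope classical_set_scope.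
Local Open Scope complex_scope.
Local Open Scope ring_scope.

(** * Power bounds and differentiation along an interval *)

(* f = O(|x - c| ^ n) as x -> c along J.  The point c is included when J c holds;
   functions that are only controlled for x != c are handled with J `\ c. *)
Definition pow_bound (R : realType) (J : set R) (c : R) (n : nat)
    (f : R -> R) : Prop :=
  exists2 K, 0 <= K & \forall x \near c, J x -> `|f x| <= K * `|x - c| ^+ n.

(* Continuity along J and differentiability in its interior are all that the mean
   value theorem needs, so one-sided derivatives at an endpoint do not occur. *)
Definition diff_on (R : realType) (J : set R) (f f' : R -> R) : Prop :=
  {within J, continuous f} /\ forall x, interior J x -> is_derive x 1 f (f' x).

Section PowBound.
Variables (R : realType) (J : set R) (c : R).
Implicit Types f g : R -> R.

Lemma pow_bound_eq n f g : (forall x, J x -> f x = g x) ->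
  pow_bound J c n f -> pow_bound J c n g.
Proof.
move=> fg [K K0 fK]; exists K => //.
by apply: filterS fK => x /[swap] Jx; rewrite fg//; exact.
Qed.

Lemma pow_boundD n f g : pow_bound J c n f -> pow_bound J c n g ->
  pow_bound J c n (fun x => f x + g x).
Proof.
move=> [K K0 fK] [L L0 gL]; exists (K + L); first exact: addr_ge0.
apply: filterS2 fK gL => x fx gx Jx; rewrite mulrDl.
by rewrite (le_trans (ler_normD _ _))// lerD ?fx ?gx.
Qed.

Lemma pow_boundN n f : pow_bound J c n f -> pow_bound J c n (fun x => - f x).
Proof.
move=> [K K0 fK]; exists K => //.
by apply: filterS fK => x fx Jx; rewrite normrN fx.
Qed.

Lemma pow_boundB n f g : pow_bound J c n f -> pow_bound J c n g ->
  pow_bound J c n (fun x => f x - g x).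
Proof. by move=> fn gn; apply: pow_boundD => //; exact: pow_boundN. Qed.

Lemma pow_boundM m n f g : pow_bound J c m f -> pow_bound J c n g ->
  pow_bound J c (m + n) (fun x => f x * g x).
Proof.
move=> [K K0 fK] [L L0 gL]; exists (K * L); first exact: mulr_ge0.
apply: filterS2 fK gL => x fx gx Jx.
by rewrite normrM exprD mulrACA ler_pM ?fx ?gx.
Qed.

Lemma pow_bound_cst (k : R) : pow_bound J c 0 (fun=> k).
Proof. by exists `|k| => //; apply: (@nearW _ (nbhs c)) => x _; rewrite mulr1. Qed.

Lemma pow_boundXB n : pow_bound J c n (fun x => (x - c) ^+ n).
Proof. by exists 1 => //; apply: (@nearW _ (nbhs c)) => x _; rewrite mul1r normrX. Qed.

Lemma pow_boundW m n f : (m <= n)%N -> pow_bound J c n f -> pow_bound J c m f.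
Proof.
move=> mn [K K0 fK]; exists K => //.
have x1 : \forall x \near c, `|x - c| <= 1.
  exists 1 => //= x; rewrite /ball_/= distrC; exact: ltW.
apply: filterS2 fK x1 => x fx x1 Jx; apply: (le_trans (fx Jx)).
by rewrite ler_wpM2l// ler_wiXn2l// x1.
Qed.

(** Near [c] the difference quotient is within 1 of [l], hence bounded by [1 + |l|]. This supplies
    the starting bounds D = O(e) and T = T(c) + O(e), also at an endpoint of [J]. *)
Lemma has_derivative_in_pow_bound f l : has_derivative_in J f c l ->
  pow_bound J c 1 (fun x => f x - f c).
Proof.
move=> /(@cvgrPdist_lt _ R^o)/(_ 1 ltr01); rewrite near_withinE => H.
exists (1 + `|l|); first by rewrite addr_ge0.
move: H; rewrite /dnbhs near_withinE; apply: filterS => x H Jx.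
have [->|xc] := eqVneq x c; first by rewrite !subrr normr0 mulr_ge0 ?addr_ge0.
have := H xc Jx; set q := _ *: _ => lq.
have -> : f x - f c = q * (x - c).
  by rewrite /q -[_ *: _]/(_ * _) mulrAC mulVf ?mul1r// subr_eq0.
rewrite normrM expr1 ler_wpM2r//.
have -> : q = l - (l - q) by ring.
by rewrite (le_trans (ler_normB _ _))// addrC lerD// ltW.
Qed.

Lemma pow_bound_cvg f : pow_bound J c 1 (fun x => f x - f c) ->
  f @ within J (nbhs c) --> f c.
Proof.
move=> [K K0 fK]; apply/cvgrPdist_le => e e0; rewrite near_withinE.
(* The constant [K] may vanish, so the radius is obtained by dividing by [K + 1]. *)
have K1 : 0 < K + 1 by rewrite ltr_wpDl.
have x1 : \forall x \near c, `|x - c| <= e / (K + 1).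
  exists (e / (K + 1)) => /=; first exact: divr_gt0.
  by move=> x; rewrite /ball_/= distrC; exact: ltW.
apply: filterS2 fK x1 => x fx x1 Jx; rewrite distrC (le_trans (fx Jx))//.
rewrite expr1 (le_trans (ler_wpM2l K0 x1))//.
by rewrite mulrA ler_pdivrMr// mulrC ler_wpM2l ?ltW// ltrDl.
Qed.

End PowBound.

(** Carathéodory's criterion: the slope function, completed by [l] at [x], is continuous at [x]. At
    an interior point the limit along [J] is a full limit. *)
Lemma has_derivative_in_is_derive (R : realType) (J : set R) (f : R -> R) x l :
  has_derivative_in J f x l -> interior J x -> is_derive x 1 f l.
Proof.
move=> fl Jx; apply/is_derive1_caratheodory.
exists (fun z => if z == x then l else (f z - f x) / (z - x)); split.
- move=> z; case: eqP => [->|/eqP]; first by rewrite !subrr mulr0.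
  by rewrite -subr_eq0 => /divfK->.
- apply/continuous_withinNx; rewrite eqxx.
  apply/cvgrPdist_lt => e e0; move/(@cvgrPdist_lt _ R^o): fl => /(_ e e0).
  rewrite near_withinE /dnbhs !near_withinE; apply: filterS2 Jx => z Jz H zx.
  by rewrite (negPf zx) -[_ / _]mulrC; exact: H.
- by rewrite eqxx.
Qed.

Lemma has_derivative_in_diff_on (R : realType) (J : set R) (f f' : R -> R) :
  (forall x, J x -> has_derivative_in J f x (f' x)) -> diff_on J f f'.
Proof.
move=> ff'; split.
  apply/subspace_continuousP => x Jx; apply: pow_bound_cvg.
  exact: has_derivative_in_pow_bound (ff' _ Jx).
move=> x Jx; apply: (has_derivative_in_is_derive (ff' x _) Jx).
exact: nbhs_singleton Jx.
Qed.

Section DiffOn.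
Variables (R : realType) (J : set R).
Implicit Types f g : R -> R.

Lemma diff_on_cst (k : R) : diff_on J (fun=> k) (fun=> 0).
Proof.
split; first exact/continuous_subspaceT/cst_continuous.
by move=> x _; exact: is_derive_cst.
Qed.

Lemma diff_onD f g f' g' : diff_on J f f' -> diff_on J g g' ->
  diff_on J (fun x => f x + g x) (fun x => f' x + g' x).
Proof.
move=> [cf df] [cg dg]; split; last first.
  by move=> x Jx; apply: is_deriveD; [exact: df|exact: dg].
by move=> x; apply: continuousD; [exact: cf|exact: cg].
Qed.

Lemma diff_onN f f' : diff_on J f f' -> diff_on J (fun x => - f x) (fun x => - f' x).
Proof.
move=> [cf df]; split; last by move=> x Jx; apply: is_deriveN; exact: df.
by move=> x; apply: continuousN; exact: cf.
Qed.

Lemma diff_onB f g f' g' : diff_on J f f' -> diff_on J g g' ->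
  diff_on J (fun x => f x - g x) (fun x => f' x - g' x).
Proof. by move=> df dg; apply: diff_onD => //; exact: diff_onN. Qed.

Lemma diff_onM f g f' g' : diff_on J f f' -> diff_on J g g' ->
  diff_on J (fun x => f x * g x) (fun x => f' x * g x + f x * g' x).
Proof.
move=> [cf df] [cg dg]; split.
  by move=> x; apply: (@continuousM R (subspace J) f g x); [exact: cf|exact: cg].
move=> x Jx; have fx := df _ Jx; have gx := dg _ Jx.
apply: (is_derive_eq (is_deriveM fx gx)).
by rewrite /GRing.scale/= addrC mulrC.
Qed.

Lemma diff_on_derivative_eq f f' g' : (forall x, J x -> f' x = g' x) ->
  diff_on J f f' -> diff_on J f g'.
Proof.
move=> fg [cf df]; split => // x Jx; rewrite -fg; first exact: df.
exact: nbhs_singleton Jx.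
Qed.

Lemma diff_on_XB (c : R) n : diff_on J (fun x => (x - c) ^+ n.+1)
  (fun x => n.+1%:R * (x - c) ^+ n).
Proof.
have diff_on_subr : diff_on J (fun x => x - c) (fun=> 1).
  have dB (x : R) : is_derive x 1 (fun y : R => y - c) 1.
    by apply: is_derive_eq (subr0 _); exact: is_deriveB.
  split=> //; apply: continuous_subspaceT => x.
  by apply/differentiable_continuous/derivable1_diffP; case: (dB x).
elim: n => [|n IH].
  by apply: diff_on_derivative_eq diff_on_subr => x _; rewrite expr0 mulr1.
apply: diff_on_derivative_eq (diff_onM diff_on_subr IH) => x _ /=.
by rewrite mulrCA -exprS -[n.+2]addn1 natrD addrC mulrDl.
Qed.

(** The open segment between two points of an interval [J] lies in the interior of [J], so at [a]
    and [b] themselves continuity along [J] is enough. *)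
Lemma MVT_is_interval f f' a b : is_interval J -> J a -> J b -> a < b ->
  diff_on J f f' -> exists2 x, x \in `]a, b[ & f b - f a = f' x * (b - a).
Proof.
move=> Ji Ja Jb ab [cf df]; apply: MVT => //.
  move=> x xab; apply: df; rewrite /interior.
  apply: filterS (near_in_itvoo xab) => y; rewrite in_itv/= => /andP[ay yb].
  by apply: Ji Ja Jb _ _; rewrite !ltW.
apply: continuous_subspaceW cf => x /=; rewrite in_itv/= => xab.
exact: Ji Ja Jb _ xab.
Qed.

(** The intermediate point given by the mean value theorem is no farther from [c] than [x], so the
    bound on [f'] there is at most [K * |x - c| ^+ n], and the factor [x - c] raises the order by
    one with the same [K]. *)
Lemma pow_bound_integrate c n f f' : is_interval J -> J c -> diff_on J f f' ->
  pow_bound J c n f' -> pow_bound J c n.+1 (fun x => f x - f c).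
Proof.
move=> Ji Jc df [K K0 /nbhs_ballP[e/= e0 f'K]]; exists K => //.
apply/nbhs_ballP; exists e => //= x; rewrite /ball/= => xe Jx.
have bnd y : J y -> `|y - c| <= `|x - c| -> `|f' y| * `|x - c| <= K * `|x - c| ^+ n.+1.
  move=> Jy yx; rewrite exprSr mulrA ler_wpM2r//.
  apply: (le_trans (f'K y _ Jy)).
    by rewrite /ball/= distrC (le_lt_trans yx)// distrC.
  by rewrite ler_wpM2l// lerXn2r ?nnegrE.
have [xc|cx|->] := ltgtP x c; last by rewrite !subrr normr0 mulr_ge0 ?exprn_ge0.
- have [y] := MVT_is_interval Ji Jx Jc xc df; rewrite in_itv/= => /andP[xy yc] fy.
  rewrite distrC fy normrM (distrC c); apply: bnd.
    by apply: Ji Jx Jc _ _; rewrite !ltW.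
  by rewrite !ltr0_norm ?subr_lt0 //; lra.
- have [y] := MVT_is_interval Ji Jc Jx cx df; rewrite in_itv/= => /andP[cy yx] fy.
  rewrite fy normrM; apply: bnd.
    by apply: Ji Jc Jx _ _; rewrite !ltW.
  by rewrite !gtr0_norm ?subr_gt0 //; lra.
Qed.

End DiffOn.

(** * Entrywise bounds and derivatives of matrices *)

Definition mx_pow_bound (R : realType) (J : set R) (c : R) (n : nat) p q
    (A : R -> 'M[R]_(p, q)) : Prop :=
  forall i j, pow_bound J c n (fun x => A x i j).

Definition mx_diff_on (R : realType) (J : set R) p q
    (A A' : R -> 'M[R]_(p, q)) : Prop :=
  forall i j, diff_on J (fun x => A x i j) (fun x => A' x i j).

Lemma has_derivative_in_coord (R : realType) (J : set R) p q
    (A : R -> 'M[R]_(p.+1, q.+1)) x L i j :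
  has_derivative_in J A x L ->
  has_derivative_in J (fun y => A y i j) x (L i j).
Proof.
move=> AL; have := cvg_comp _ _ AL (@coord_continuous R p.+1 q.+1 i j L).
by apply: cvg_trans; apply: near_eq_cvg; apply: nearW => y /=; rewrite !mxE.
Qed.

Section MxPowBound.
Variables (R : realType) (J : set R) (c : R).

Lemma pow_bound_sum n I (r : seq I) (F : I -> R -> R) :
  (forall i, pow_bound J c n (F i)) ->
  pow_bound J c n (fun x => \sum_(i <- r) F i x).
Proof.
move=> Fn; elim: r => [|i r IH].
  apply: (pow_bound_eq (f := fun=> 0)) => [x _|]; first by rewrite big_nil.
  by exists 0 => //; apply: (@nearW _ (nbhs c)) => x _; rewrite normr0 mul0r.
apply: pow_bound_eq (pow_boundD (Fn i) IH) => x _.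
by rewrite big_cons.
Qed.

Lemma mx_pow_bound_eq n p q (A B : R -> 'M[R]_(p, q)) :
  (forall x, J x -> A x = B x) -> mx_pow_bound J c n A -> mx_pow_bound J c n B.
Proof. by move=> AB An i j; apply: pow_bound_eq (An i j) => x /AB ->. Qed.

Lemma mx_pow_boundW m n p q (A : R -> 'M[R]_(p, q)) : (m <= n)%N ->
  mx_pow_bound J c n A -> mx_pow_bound J c m A.
Proof. by move=> mn An i j; exact: pow_boundW mn (An i j). Qed.

Lemma mx_pow_boundD n p q (A B : R -> 'M[R]_(p, q)) : mx_pow_bound J c n A ->
  mx_pow_bound J c n B -> mx_pow_bound J c n (fun x => A x + B x).
Proof.
move=> An Bn i j; apply: pow_bound_eq (pow_boundD (An i j) (Bn i j)) => x _.
by rewrite mxE.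
Qed.

Lemma mx_pow_boundB n p q (A B : R -> 'M[R]_(p, q)) : mx_pow_bound J c n A ->
  mx_pow_bound J c n B -> mx_pow_bound J c n (fun x => A x - B x).
Proof.
move=> An Bn i j; apply: pow_bound_eq (pow_boundB (An i j) (Bn i j)) => x _.
by rewrite !mxE.
Qed.

Lemma mx_pow_boundM m n p q r (A : R -> 'M[R]_(p, q)) (B : R -> 'M[R]_(q, r)) :
  mx_pow_bound J c m A -> mx_pow_bound J c n B ->
  mx_pow_bound J c (m + n) (fun x => A x *m B x).
Proof.
move=> An Bn i j; have H k : pow_bound J c (m + n) (fun x => A x i k * B x k j).
  exact: pow_boundM.
have := pow_bound_sum (index_enum 'I_q) H.
by apply: pow_bound_eq => x _; rewrite mxE.
Qed.

Lemma mx_pow_boundZ m n p q (f : R -> R) (A : R -> 'M[R]_(p, q)) :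
  pow_bound J c m f -> mx_pow_bound J c n A ->
  mx_pow_bound J c (m + n) (fun x => f x *: A x).
Proof.
move=> fm An i j; apply: pow_bound_eq (pow_boundM fm (An i j)) => x _.
by rewrite mxE.
Qed.

Lemma mx_pow_bound_cst p q (M : 'M[R]_(p, q)) : mx_pow_bound J c 0 (fun=> M).
Proof. by move=> i j; exact: pow_bound_cst. Qed.

Lemma has_derivative_in_mx_pow_bound p q (A : R -> 'M[R]_(p.+1, q.+1)) L :
  has_derivative_in J A c L -> mx_pow_bound J c 1 (fun x => A x - A c).
Proof.
move=> AL i j.
have := has_derivative_in_pow_bound (has_derivative_in_coord (i := i) (j := j) AL).
by apply: pow_bound_eq => x _; rewrite !mxE.
Qed.

Lemma mx_pow_bound_integrate n p q (A A' : R -> 'M[R]_(p, q)) :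
  is_interval J -> J c -> mx_diff_on J A A' -> mx_pow_bound J c n A' ->
  mx_pow_bound J c n.+1 (fun x => A x - A c).
Proof.
move=> Ji Jc dA A'n i j.
apply: pow_bound_eq (pow_bound_integrate Ji Jc (dA i j) (A'n i j)) => x _.
by rewrite !mxE.
Qed.

End MxPowBound.

Section MxDiffOn.
Variables (R : realType) (J : set R).

Lemma has_derivative_in_mx_diff_on p q (A A' : R -> 'M[R]_(p.+1, q.+1)) :
  (forall x, J x -> has_derivative_in J A x (A' x)) -> mx_diff_on J A A'.
Proof.
move=> AA' i j; apply: has_derivative_in_diff_on => x Jx.
exact: has_derivative_in_coord (AA' x Jx).
Qed.

Lemma diff_on_eq (f g f' g' : R -> R) : f =1 g -> f' =1 g' ->
  diff_on J f f' -> diff_on J g g'.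
Proof. by move=> /funext -> /funext ->. Qed.

Lemma mx_diff_onB p q (A B A' B' : R -> 'M[R]_(p, q)) :
  mx_diff_on J A A' -> mx_diff_on J B B' ->
  mx_diff_on J (fun x => A x - B x) (fun x => A' x - B' x).
Proof.
move=> dA dB i j; apply: diff_on_eq (diff_onB (dA i j) (dB i j)) => x;
  by rewrite !mxE.
Qed.

Lemma mx_diff_onZ p q (f f' : R -> R) (M : 'M[R]_(p, q)) : diff_on J f f' ->
  mx_diff_on J (fun x => f x *: M) (fun x => f' x *: M).
Proof.
move=> df i j.
apply: diff_on_eq (diff_onM df (diff_on_cst J (M i j))) => x; rewrite !mxE//.
by rewrite mulr0 addr0.
Qed.

(** The shape is that of a Taylor term e^(n+1)/k M, to be subtracted from a function before its
    derivative is bounded and integrated. *)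
Lemma mx_diff_on_XB p q (c k : R) n (M : 'M[R]_(p, q)) :
  mx_diff_on J (fun x => (x - c) ^+ n.+1 / k *: M)
    (fun x => (n.+1%:R / k) * (x - c) ^+ n *: M).
Proof.
apply: mx_diff_onZ.
apply: diff_on_eq (diff_onM (diff_on_XB J c n) (diff_on_cst J k^-1)) => x //.
by rewrite mulr0 addr0 mulrAC.
Qed.

End MxDiffOn.

(** * Expansions at a zero of D *)

Section FocusExpansion.
Variables (R : realType) (J : set R) (c : R) (T D D' : R -> 'M[R]_2).
Hypotheses (J_itv : is_interval J) (Jc : J c).
Hypothesis T_lip : mx_pow_bound J c 1 (fun x => T x - T c).
Hypothesis D_deriv : forall x, J x -> has_derivative_in J D x (D' x).
Hypothesis D'_deriv : forall x, J x -> has_derivative_in J D' x (T x *m D x).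
Hypothesis Dc : D c = 0.

Let P := D' c.
Let TP := T c *m D' c.

Let dD := has_derivative_in_mx_diff_on D_deriv.
Let dD' := has_derivative_in_mx_diff_on D'_deriv.

Let T_O0 : mx_pow_bound J c 0 T.
Proof.
have := mx_pow_boundD (mx_pow_boundW (leq0n _) T_lip) (mx_pow_bound_cst J c (T c)).
by apply: mx_pow_bound_eq => x _; rewrite subrK.
Qed.

Lemma focus_O1 : mx_pow_bound J c 1 D.
Proof.
have := has_derivative_in_mx_pow_bound (D_deriv Jc).
by apply: mx_pow_bound_eq => x _; rewrite Dc subr0.
Qed.

(** Here D'' = T D is O(1) O(e), and one integration gains an order. *)
Lemma focus_deriv_O2 : mx_pow_bound J c 2 (fun x => D' x - P).
Proof.
apply: (mx_pow_bound_integrate J_itv Jc dD').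
exact: (@mx_pow_boundM _ _ _ 0 1) T_O0 focus_O1.
Qed.

Lemma focus_O3 : mx_pow_bound J c 3 (fun x => D x - (x - c) *: P).
Proof.
have d1 := mx_diff_onB dD (mx_diff_on_XB J c 1 0 P).
have : mx_pow_bound J c 2 (fun x => D' x - 1%:R / 1 * (x - c) ^+ 0 *: P).
  by apply: mx_pow_bound_eq focus_deriv_O2 => x _; rewrite expr0 divr1 mulr1 scale1r.
move=> /(mx_pow_bound_integrate J_itv Jc d1); apply: mx_pow_bound_eq => x _.
by rewrite Dc subrr !expr1 mul0r scale0r !subr0 divr1.
Qed.

(** Write T D - e T(c) P as (T - T(c)) D + T(c) (D - e P). The first product is O(e) O(e), the
    second is O(e^3), so the sum is O(e^2) and integrates to O(e^3). *)
Lemma focus_deriv_expansion :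
  mx_pow_bound J c 3 (fun x => D' x - P - ((x - c) ^+ 2 / 2) *: TP).
Proof.
have d1 := mx_diff_onB dD' (mx_diff_on_XB J c 2 1 TP).
have : mx_pow_bound J c 2 (fun x => T x *m D x - 2%:R / 2 * (x - c) ^+ 1 *: TP).
  have TD := mx_pow_boundM T_lip focus_O1.
  have TDP := mx_pow_boundM (mx_pow_bound_cst J c (T c)) focus_O3.
  apply: mx_pow_bound_eq (mx_pow_boundD TD (mx_pow_boundW (leqnSn 2) TDP)) => x _.
  rewrite mulmxBl mulmxBr divff// mul1r expr1 -scalemxAr -/TP.
  by rewrite addrA subrK.
move=> /(mx_pow_bound_integrate J_itv Jc d1); apply: mx_pow_bound_eq => x _.
by rewrite subrr expr0n mul0r scale0r subr0 addrAC.
Qed.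

(** Integrating the expansion of D' once more turns e^2/2 into e^3/6; the derivative of the latter
    appears as 3/6 e^2. *)
Lemma focus_expansion :
  mx_pow_bound J c 4 (fun x => D x - (x - c) *: P - ((x - c) ^+ 3 / 6) *: TP).
Proof.
have d1 := mx_diff_onB (mx_diff_onB dD (mx_diff_on_XB J c 1 0 P))
  (mx_diff_on_XB J c 6 2 TP).
have : mx_pow_bound J c 3 (fun x => D' x - 1%:R / 1 * (x - c) ^+ 0 *: P -
    3%:R / 6 * (x - c) ^+ 2 *: TP).
  apply: mx_pow_bound_eq focus_deriv_expansion => x _.
  rewrite expr0 divr1 mulr1 scale1r; congr (_ - _ *: _).
  by field.
move=> /(mx_pow_bound_integrate J_itv Jc d1); apply: mx_pow_bound_eq => x _.
by rewrite Dc subrr !expr1 expr0n !mul0r !scale0r !subr0 divr1.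
Qed.

End FocusExpansion.

(** * Symmetry of the deformation matrix, nondegeneracy at a focus *)

Lemma det_mx2 (R : comNzRingType) (A : 'M[R]_2) :
  \det A = A 0 0 * A 1 1 - A 0 1 * A 1 0.
Proof.
rewrite (expand_det_row _ 0) !big_ord_recl big_ord0 /cofactor !det_mx11 !mxE.
rewrite addr0 /= expr0 expr1 mul1r mulN1r mulrN.
by congr (_ * A _ _ - A _ _ * A _ _); apply/val_inj.
Qed.

Lemma ord2_cases (k : 'I_2) : k = 0 \/ k = 1.
Proof. by case: k => [[|[|//]] ?]; [left|right]; apply/val_inj. Qed.

Lemma adj_mx2 (R : comNzRingType) (A : 'M[R]_2) :
  \adj A = \matrix_(i, j) (if i == j then A (1 - i) (1 - j) else - A i j).
Proof.
apply/matrixP => i j; rewrite !mxE /cofactor !det_mx11 !mxE.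
by case: (ord2_cases i) => ->; case: (ord2_cases j) => -> /=;
  rewrite ?expr0 ?expr1 ?sqrrN ?expr1n ?mul1r ?mulN1r;
  [|congr (- _)|congr (- _)|]; congr (A _ _); apply/val_inj.
Qed.

Lemma mulmx2 (R : nzRingType) p q (A : 'M[R]_(p, 2)) (B : 'M[R]_(2, q)) i j :
  (A *m B) i j = A i 0 * B 0 j + A i 1 * B 1 j.
Proof.
rewrite mxE !big_ord_recl big_ord0 addr0.
by congr (_ + A _ _ * B _ _); apply/val_inj.
Qed.

(** With the adjugate in place of the inverse, estimates concern only products of entries of D and
    D', and the division by the determinant is postponed. *)
Lemma mul_adj_deformation (R : realType) (D D' : R -> 'M[R]_2) x :
  D x \in unitmx ->
  D' x *m \adj (D x) = \det (D x) *: deformation D D' x.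
Proof.
move=> Du; rewrite /deformation /invmx Du -scalemxAr scalerA divff ?scale1r//.
by rewrite -unitfE -unitmxE.
Qed.

Section Wronskian.
Variables (R : realType) (J : set R) (T D D' : R -> 'M[R]_2).
Hypotheses (J_itv : is_interval J) (J0 : J 0) (J_ge0 : forall x, J x -> 0 <= x).
Hypothesis T_sym : forall x, J x -> (T x)^T = T x.
Hypotheses (dD : mx_diff_on J D D') (dD' : mx_diff_on J D' (fun x => T x *m D x)).
Hypothesis D_init : D 0 = 0.

(** The difference of the two sides is the off-diagonal entry of D^T D' - D'^T D. Its derivative
    vanishes because T is symmetric, and its value at 0 is zero because D(0) = 0. *)
Lemma wronskian x : J x -> D x 0 0 * D' x 0 1 + D x 1 0 * D' x 1 1 =
  D' x 0 0 * D x 0 1 + D' x 1 0 * D x 1 1.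
Proof.
pose W y := D y 0 0 * D' y 0 1 + D y 1 0 * D' y 1 1 -
  (D' y 0 0 * D y 0 1 + D' y 1 0 * D y 1 1).
move=> Jx; have dW : diff_on J W (fun=> 0).
  have := diff_onB
    (diff_onD (diff_onM (dD 0 0) (dD' 0 1)) (diff_onM (dD 1 0) (dD' 1 1)))
    (diff_onD (diff_onM (dD' 0 0) (dD 0 1)) (diff_onM (dD' 1 0) (dD 1 1))).
  apply: diff_on_derivative_eq => y Jy; rewrite !mulmx2.
  have T10 : T y 1 0 = T y 0 1 by rewrite -[in LHS](T_sym Jy) mxE.
  by rewrite T10; ring.
have := J_ge0 Jx; rewrite le_eqVlt => /predU1P[<-|x0].
  by rewrite D_init !mxE; ring.
have [y _] := MVT_is_interval J_itv J0 Jx x0 dW.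
rewrite /W D_init !mxE mul0r => /eqP.
by rewrite !mul0r !mulr0 !addr0 !subr0 subr_eq0 => /eqP.
Qed.

Lemma deformation_sym x : J x -> D x \in unitmx ->
  deformation D D' x = optical_mx (theta D D' x) (sigma D D' x).
Proof.
move=> Jx Du; rewrite /theta /sigma optical_mxK//.
have d0 : \det (D x) != 0 by rewrite -unitfE -unitmxE.
(* The two off-diagonal entries of D' adj(D) differ exactly by the Wronskian. *)
have : (\det (D x) *: deformation D D' x)^T = \det (D x) *: deformation D D' x.
  rewrite -mul_adj_deformation//; apply/matrixP => i j; rewrite mxE !mulmx2 adj_mx2 !mxE.
  have W := wronskian Jx.
  by case: (ord2_cases i) => ->; case: (ord2_cases j) => -> //=;
    rewrite ?subrr ?subr0; move: W; lra.
by rewrite linearZ/= => /(scalerI d0).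
Qed.

End Wronskian.

(** * Gronwall's inequality and uniqueness for the Cauchy problem *)

Lemma diff_on_expR (R : realType) (J : set R) (k : R) :
  diff_on J (fun x => expR (k * x)) (fun x => k * expR (k * x)).
Proof.
have dE (x : R) : is_derive x 1 (fun y : R => expR (k * y)) (k * expR (k * x)).
  have dk : is_derive x 1 (fun y : R => k * y) k.
    by apply: is_derive_eq (scaler1 k); exact: is_deriveZ.
  by apply: (is_derive_eq (is_derive1_comp (is_derive_expR (k * x)) dk)); rewrite mulrC.
split=> //; apply: continuous_subspaceT => x.
by apply/differentiable_continuous/derivable1_diffP; case: (dE x).
Qed.

(** The product E(x) exp(K x) has derivative (E' + K E) exp(K x) >= 0 and vanishes at [b], so it
    cannot be positive at the earlier point [a]. *)
Lemma backward_gronwall (R : realType) (J : set R) (E E' : R -> R) (K a b : R) :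
  is_interval J -> J a -> J b -> a < b -> diff_on J E E' ->
  (forall x, a <= x <= b -> - K * E x <= E' x) -> E b = 0 -> E a <= 0.
Proof.
move=> Ji Ja Jb ab dE EK Eb.
have [x xab] := MVT_is_interval Ji Ja Jb ab (diff_onM dE (diff_on_expR J K)).
rewrite Eb mul0r sub0r => H.
have : 0 <= - (E a * expR (K * a)).
  rewrite H mulr_ge0 ?subr_ge0 ?(ltW ab)// mulrA -mulrDl mulr_ge0 ?expR_ge0//.
  have := EK x; move: xab; rewrite in_itv/= => /andP[ax xb].
  by rewrite (ltW ax) (ltW xb) => /(_ isT); lra.
by rewrite oppr_ge0 pmulr_lle0 ?expR_gt0.
Qed.

Lemma is_interval_segment_subset (R : realType) (J : set R) a b :
  is_interval J -> J a -> J b -> `[a, b] `<=` J.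
Proof. by move=> Ji Ja Jb x /=; rewrite in_itv/= => xab; exact: Ji Ja Jb _ xab. Qed.

Lemma mul_bound_sqr (R : realType) (t x y E : R) : x ^+ 2 + y ^+ 2 <= E ->
  - (`|t| * E) <= 2 * (t * x * y).
Proof.
move=> xyE; have xy : `|2 * (x * y)| <= E.
  have := sqr_ge0 (x + y); have := sqr_ge0 (x - y).
  rewrite ler_norml; lra.
have -> : 2 * (t * x * y) = t * (2 * (x * y)) by ring.
rewrite lerNl (le_trans (ler_norm _))// normrN normrM.
by rewrite ler_wpM2l.
Qed.

(** The energy E = |u|^2 + |u'|^2 satisfies E' = 2 u.u' + 2 u'.T u >= -(1 + h) E, where h is the sum
    of the moduli of the entries of T. On the compact segment h is at most its maximum h(m), so
    backward Gronwall carries E = 0 from [b] to [a]. *)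
Lemma second_order_uniqueness (R : realType) (J : set R) (T : R -> 'M[R]_2)
    (u u' : R -> 'cV[R]_2) a b :
  is_interval J -> J a -> J b -> a < b ->
  (forall i j, {within J, continuous (fun x => T x i j)}) ->
  mx_diff_on J u u' -> mx_diff_on J u' (fun x => T x *m u x) ->
  u b = 0 -> u' b = 0 -> u' a = 0.
Proof.
move=> Ji Ja Jb ab cT du du' ub u'b.
pose h x := `|T x 0 0| + `|T x 0 1| + `|T x 1 0| + `|T x 1 1|.
have ch : {within `[a, b], continuous h}.
  apply: (continuous_subspaceW (is_interval_segment_subset Ji Ja Jb)).
  have cn i j : {within J, continuous (fun x => `|T x i j|)}.
    by move=> x; apply: (continuous_comp (cT i j x)); exact: norm_continuous.
  by do 3![apply: within_continuousD; last exact: cn]; exact: cn.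
have [m mab hm] := EVT_max (ltW ab) ch.
pose E x := u x 0 0 * u x 0 0 + u x 1 0 * u x 1 0 +
  (u' x 0 0 * u' x 0 0 + u' x 1 0 * u' x 1 0).
have dE := diff_onD
  (diff_onD (diff_onM (du 0 0) (du 0 0)) (diff_onM (du 1 0) (du 1 0)))
  (diff_onD (diff_onM (du' 0 0) (du' 0 0)) (diff_onM (du' 1 0) (du' 1 0))).
have : E a <= 0.
  (* 2 |u.u'| <= E and 2 |T_ij u'_i u_j| <= |T_ij| E *)
  apply: (backward_gronwall (K := 1 + h m) Ji Ja Jb ab dE); last first.
    by rewrite ub u'b !mxE; ring.
  move=> x xab; rewrite -/(E x) !mulmx2.
  have E0 : 0 <= E x by rewrite /E; nra.
  have hE : h x * E x <= h m * E x.
    by rewrite ler_wpM2r// hm// in_itv.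
  have uu i : - (`|1| * E x) <= 2 * (1 * u x 0 0 * u' x 0 0).
    by apply: mul_bound_sqr; rewrite /E; nra.
  have B i j : - (`|T x i j| * E x) <= 2 * (T x i j * u' x i 0 * u x j 0).
    apply: mul_bound_sqr; rewrite /E.
    by case: (ord2_cases i) => ->; case: (ord2_cases j) => ->; nra.
  (* Adding the squares of the u_i + u'_i to nothing negative gives E + 2 u.u' >= 0. *)
  have U : - E x <= 2 * (u x 0 0 * u' x 0 0 + u x 1 0 * u' x 1 0).
    have := sqr_ge0 (u x 0 0 + u' x 0 0); have := sqr_ge0 (u x 1 0 + u' x 1 0).
    rewrite /E; lra.
  have := B 0 0; have := B 0 1; have := B 1 0; have := B 1 1.
  move: U hE; rewrite /h; lra.
move=> Ea; have w0 : u' a 0 0 = 0 /\ u' a 1 0 = 0 by move: Ea; rewrite /E; split; nra.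
apply/matrixP => i j; rewrite mxE ord1.
by case: w0 => w0 w1; case: (ord2_cases i) => ->.
Qed.

Lemma focus_det_neq0 (R : realType) (J : set R) (T D D' : R -> 'M[R]_2) c :
  is_interval J -> J 0 -> J c -> 0 < c ->
  (forall i j, {within J, continuous (fun x => T x i j)}) ->
  mx_diff_on J D D' -> mx_diff_on J D' (fun x => T x *m D x) ->
  D' 0 = 1%:M -> D c = 0 -> \det (D' c) != 0.
Proof.
(* The lemma [det0P] yields a row vector annihilating a matrix from the left; transposing first
   makes [v^T] a kernel vector of [D' c]. *)
move=> Ji J0 Jc c0 cT dD dD' D'0 Dc; rewrite -det_tr.
apply/negP => /det0P[v v0 vD].
have kerv : D' c *m v^T = 0 by rewrite -[D' c]trmxK -trmx_mul vD trmx0.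
have dmul (A A' : R -> 'M[R]_2) : mx_diff_on J A A' ->
    mx_diff_on J (fun x => A x *m v^T) (fun x => A' x *m v^T).
  move=> dA i j; have dv k := diff_on_cst J (v^T k j).
  apply: diff_on_eq (diff_onD (diff_onM (dA i 0) (dv 0)) (diff_onM (dA i 1) (dv 1))) => x;
    by rewrite !mulmx2 ?mulr0 ?addr0.
have du' : mx_diff_on J (fun x => D' x *m v^T) (fun x => T x *m (D x *m v^T)).
  by move=> i j; apply: diff_on_eq (dmul _ _ dD' i j) => x //; rewrite mulmxA.
have := second_order_uniqueness Ji J0 Jc c0 cT (dmul _ _ dD) du'.
rewrite Dc mul0mx kerv D'0 mul1mx => /(_ erefl erefl)/(congr1 trmx).
by rewrite trmxK trmx0 => /eqP; rewrite (negPf v0).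
Qed.

(** * Expansions of the determinant and of the optical scalars *)

(** Once K |x - c| <= d/2, the error K |x - c|^(n+1) consumes at most half of the main term d |x -
    c|^n. *)
Lemma pow_bound_minorant (R : realType) (J : set R) (c d : R) n f : 0 < d ->
  pow_bound J c n.+1 (fun x => f x - `|x - c| ^+ n * d) ->
  \forall x \near c, J x -> d / 2 * `|x - c| ^+ n <= f x.
Proof.
move=> d0 [K K0 fK].
have K1 : 0 < K + 1 by rewrite ltr_wpDl.
have e0 : 0 < d / 2 / (K + 1) by rewrite !divr_gt0.
have xe : \forall x \near c, `|x - c| <= d / 2 / (K + 1).
  by exists (d / 2 / (K + 1)) => //= x; rewrite /ball_/= distrC; exact: ltW.
apply: filterS2 fK xe => x fx xe Jx; have := fx Jx; rewrite ler_norml => /andP[{}fx _].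
move: xe; rewrite ler_pdivlMr// => xe; move: fx; rewrite exprS.
have z0 : 0 <= `|x - c| ^+ n by rewrite exprn_ge0.
have := ler_wpM2r z0 xe; have := mulr_ge0 (normr_ge0 (x - c)) z0; lra.
Qed.

(** A lower bound of order [n] for [g] allows division of a bound for [f * g]. The set [J] avoids
    [c], where the factor [|x - c| ^+ n] could not be cancelled. *)
Lemma pow_bound_cancel (R : realType) (J : set R) (c k : R) m n f g : 0 < k ->
  (forall x, J x -> x != c) -> (\forall x \near c, J x -> k * `|x - c| ^+ n <= `|g x|) ->
  pow_bound J c (m + n) (fun x => f x * g x) -> pow_bound J c m f.
Proof.
move=> k0 Jc gk [K K0 fgK]; exists (K / k); first by rewrite divr_ge0 // ltW.
apply: filterS2 gk fgK => x gx fgx Jx.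
have xc : 0 < `|x - c| ^+ n by rewrite exprn_gt0// normr_gt0 subr_eq0 Jc.
have := fgx Jx; rewrite normrM exprD mulrA => fgx'.
have : `|f x| * (k * `|x - c| ^+ n) <= K * `|x - c| ^+ m * `|x - c| ^+ n.
  by apply: le_trans fgx'; rewrite ler_wpM2l// gx.
by rewrite mulrA ler_pM2r// => H; rewrite mulrAC ler_pdivlMr.
Qed.

Lemma cmod_ge0 (R : realType) (z : R[i]) : 0 <= cmod z.
Proof. by case: z => a b; exact: sqrtr_ge0. Qed.

Lemma cmod_le (R : realType) (z : R[i]) : cmod z <= `|complex.Re z| + `|complex.Im z|.
Proof.
case: z => a b; rewrite /cmod /= -[leRHS]ger0_norm ?addr_ge0// -sqrtr_sqr.
rewrite ler_wsqrtr// sqrrD !real_normK ?num_real// addrAC lerDl.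
by rewrite mulrn_wge0// mulr_ge0.
Qed.

Section OpticalExpansion.
Variables (R : realType) (J : set R) (c : R) (T D D' : R -> 'M[R]_2).
Hypotheses (J_itv : is_interval J) (Jc : J c).
Hypothesis T_lip : mx_pow_bound J c 1 (fun x => T x - T c).
Hypothesis D_deriv : forall x, J x -> has_derivative_in J D x (D' x).
Hypothesis D'_deriv : forall x, J x -> has_derivative_in J D' x (T x *m D x).
Hypothesis Dc : D c = 0.
Hypothesis d_neq0 : \det (D' c) != 0.

Let d := \det (D' c).
Let Rc := scalar_part (T c).

Lemma mx_pow_bound_adj n (A : R -> 'M[R]_2) :
  mx_pow_bound J c n A -> mx_pow_bound J c n (fun x => \adj (A x)).
Proof.
move=> An i j; have [ij|ij] := eqVneq i j.
  by apply: pow_bound_eq (An (1 - i) (1 - j)) => x _; rewrite adj_mx2 mxE ij eqxx.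
by apply: pow_bound_eq (pow_boundN (An i j)) => x _; rewrite adj_mx2 mxE (negPf ij).
Qed.

(** Split D = M + N with M the Taylor polynomial and N = O(e^4). The mixed terms of the determinant
    are O(e) O(e^4), and det N is of higher order. Moreover det M = e^2 d det(I + e^2/6 T(c)) = e^2
    d (1 + e^2/6 tr T(c) + e^4/36 det T(c)), with tr T(c) = 2 [Rc]; the last term is [X6]. *)
Lemma focus_det_expansion : pow_bound J c 5
  (fun x => \det (D x) - (x - c) ^+ 2 * (1 + (x - c) ^+ 2 / 3 * Rc) * d).
Proof.
pose M x := (x - c) *: D' c + ((x - c) ^+ 3 / 6) *: (T c *m D' c).
pose N x := D x - M x.
have M1 : mx_pow_bound J c 1 M.
  apply: mx_pow_boundD.
    exact: (mx_pow_boundZ (pow_boundXB J c 1) (mx_pow_bound_cst _ _ _)).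
  have X3 := pow_boundM (pow_boundXB J c 3) (pow_bound_cst J c 6^-1).
  apply: (mx_pow_boundW _ (mx_pow_boundZ X3 (mx_pow_bound_cst J c _))).
  by [].
have N4 : mx_pow_bound J c 4 N.
  have := focus_expansion J_itv Jc T_lip D_deriv D'_deriv Dc.
  by apply: mx_pow_bound_eq => x _; rewrite /N /M opprD addrA.
have MN i j k l : pow_bound J c 5 (fun x => M x i j * N x k l).
  exact: (pow_boundM (M1 i j) (N4 k l)).
have NN i j k l : pow_bound J c 5 (fun x => N x i j * N x k l).
  exact: (pow_boundW _ (pow_boundM (N4 i j) (N4 k l))).
have X6 : pow_bound J c 5 (fun x => (x - c) ^+ 6 * (\det (T c) * d / 36)).
  exact: (pow_boundW _ (pow_boundM (pow_boundXB J c 6) (pow_bound_cst J c _))).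
have := pow_boundD (pow_boundD
  (pow_boundB (pow_boundD (MN 0 0 1 1) (MN 1 1 0 0))
    (pow_boundD (MN 0 1 1 0) (MN 1 0 0 1)))
  (pow_boundB (NN 0 0 1 1) (NN 0 1 1 0))) X6.
apply: pow_bound_eq => x _.
have NE i j : N x i j = D x i j - M x i j by rewrite mxE [in X in _ + X]mxE.
have ME i j : M x i j = (x - c) * D' c i j +
    (x - c) ^+ 3 / 6 * (T c i 0 * D' c 0 j + T c i 1 * D' c 1 j).
  by rewrite mxE [X in X + _]mxE [X in _ + X]mxE mulmx2.
rewrite /Rc /d /scalar_part !det_mx2 !NE !ME.
by field.
Qed.

Lemma focus_det_leading :
  pow_bound J c 4 (fun x => \det (D x) - (x - c) ^+ 2 * d).
Proof.
have X4 := pow_boundM (pow_boundXB J c 4) (pow_bound_cst J c (Rc / 3 * d)).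
have := pow_boundD (pow_boundW (leqnSn 4) focus_det_expansion) X4.
by apply: pow_bound_eq => x _; field.
Qed.

(** The factor [Num.sg d] makes the leading term [|d| * (x - c) ^+ 2] positive, which treats both
    signs of [d] at once. *)
Lemma focus_det_minorant : \forall x \near c, J x ->
  `|d| / 2 * `|x - c| ^+ 2 <= Num.sg d * \det (D x).
Proof.
apply: pow_bound_minorant; first by rewrite normr_gt0.
have := pow_boundM (pow_bound_cst J c (Num.sg d))
  (pow_boundW (leqnSn 3) focus_det_leading).
by apply: pow_bound_eq => x _; rewrite mulrBr real_normK ?num_real// normrEsg; ring.
Qed.

Lemma focus_sgr_det : \forall x \near c, J x -> x != c ->
  Num.sg (\det (D x)) = Num.sg d.
Proof.
apply: filterS focus_det_minorant => x + Jx xc => /(_ Jx) H.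
have : 0 < Num.sg d * \det (D x).
  by apply: lt_le_trans H; rewrite mulr_gt0 ?divr_gt0 ?exprn_gt0 ?normr_gt0 ?subr_eq0.
move/gtr0_sg; rewrite sgrM sgr_id => /(congr1 (fun y => Num.sg d * y)).
by rewrite mulrA mulr1 -expr2 sqr_sg d_neq0 mul1r.
Qed.

Lemma focus_unitmx : \forall x \near c, J x -> x != c -> D x \in unitmx.
Proof.
apply: filterS focus_sgr_det => x H Jx xc.
by rewrite unitmxE unitfE -sgr_eq0 H// sgr_eq0.
Qed.

Lemma focus_deformation_expansion : mx_pow_bound (J `\ c) c 2
  (fun x => deformation D D' x - ((x - c)^-1 *: 1%:M + ((x - c) / 3) *: T c)).
Proof.
pose X x := deformation D D' x - ((x - c)^-1 *: 1%:M + ((x - c) / 3) *: T c).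
(* The terms of order e cancel, and those of order e^3 have total coefficient 1/2 - 1/6 - 1/3 = 0,
   which explains the order 4. *)
pose G x := (x - c) *: D' x - D x - ((x - c) ^+ 2 / 3) *: (T c *m D x).
have G4 : mx_pow_bound J c 4 G.
  have E1 := mx_pow_boundZ (pow_boundXB J c 1)
    (focus_deriv_expansion J_itv Jc T_lip D_deriv D'_deriv Dc).
  have E2 := focus_expansion J_itv Jc T_lip D_deriv D'_deriv Dc.
  have X2 := pow_boundM (pow_boundXB J c 2) (pow_bound_cst J c 3^-1).
  have E3 := mx_pow_boundZ X2 (mx_pow_boundM (mx_pow_bound_cst J c (T c))
    (focus_O3 J_itv Jc T_lip D_deriv D'_deriv Dc)).
  have := mx_pow_boundB (mx_pow_boundB E1 E2) (mx_pow_boundW (leqnSn 4) E3).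
  apply: mx_pow_bound_eq => x _; rewrite /G mulmxBr -scalemxAr.
  move: (T c *m D' c) (T c *m D x) => TP TD; apply/matrixP => i j.
  by rewrite !mxE; field.
(* Since D adj(D) = det D I, multiplying G by the adjugate produces e det D times the sought
   remainder. *)
have GX : \forall x \near c, (J `\ c) x ->
    G x *m \adj (D x) = ((x - c) * \det (D x)) *: X x.
  apply: filterS focus_unitmx => x Du [Jx /eqP xc].
  have {}Du := Du Jx xc; have xc0 : x - c != 0 by rewrite subr_eq0.
  rewrite /G !mulmxBl -!scalemxAl mul_adj_deformation// -mulmxA mul_mx_adj.
  rewrite /X scalerBr scalerDr !scalerA mul_mx_scalar opprD addrA scalerA.
  congr (_ - _ - _ *: _); last by field.
  by rewrite mulrAC divff// mul1r scale_scalar_mx mulr1.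
move=> i j; pose k := `|d| / 2.
have k0 : 0 < k by rewrite divr_gt0 ?normr_gt0.
(* G adj(D) is O(e^5) and e det D is at least |d|/2 |e|^3 in modulus, so order 5 - 3 = 2 remains. *)
apply: (pow_bound_cancel (k := k) (n := 3) (g := fun x => (x - c) * \det (D x))) => //.
- by move=> x [_ /eqP].
- apply: filterS focus_det_minorant => x H [/H {}H _].
  rewrite normrM exprS mulrCA ler_wpM2l// (le_trans H)//.
  by rewrite (le_trans (ler_norm _))// normrM normr_sg d_neq0 mul1r.
have [K K0 GK] := mx_pow_boundM G4 (mx_pow_bound_adj (focus_O1 Jc D_deriv Dc)) i j.
exists K => //; apply: filterS2 GX GK => x GX GK [Jx xc].
by have := GK Jx; rewrite GX// mxE mulrC.
Qed.

Lemma focus_theta_expansion : pow_bound (J `\ c) c 2 (fun x => theta D D' x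
  - (x - c)^-1 * (1 + 3^-1 * Rc * (x - c) ^+ 2)).
Proof.
have X2 := focus_deformation_expansion.
have := pow_boundM (pow_boundD (X2 0 0) (X2 1 1)) (pow_bound_cst (J `\ c) c 2^-1).
apply: pow_bound_eq => x [_ /eqP xc].
have xc0 : x - c != 0 by rewrite subr_eq0.
by rewrite /theta /Rc /scalar_part !mxE /=; field.
Qed.

(** The singular term e^-1 I has no shear part, so only e/3 T(c) contributes; the real and imaginary
    parts of the remainder are bounded separately. *)
Lemma focus_sigma_expansion : pow_bound (J `\ c) c 2
  (fun x => cmod (sigma D D' x - (3^-1 * (x - c))%:C * shear_part (T c))).
Proof.
have X2 := focus_deformation_expansion.
have [K K0 reK] := pow_boundM (pow_boundB (X2 1 1) (X2 0 0))
  (pow_bound_cst (J `\ c) c 2^-1).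
have [L L0 imL] := X2 0 1.
exists (K + L); first exact: addr_ge0.
apply: filterS2 reK imL => x + + Jx => /(_ Jx) + /(_ Jx).
rewrite /sigma; move: (deformation D D' x) => S re im.
have xc0 : x - c != 0 by case: Jx => _ /eqP; rewrite subr_eq0.
rewrite ger0_norm ?cmod_ge0// mulrDl (le_trans (cmod_le _))// lerD//.
  apply: le_trans re; rewrite le_eqVlt; apply/orP; left; apply/eqP.
  by congr `|_|; rewrite !mxE /=; field.
apply: le_trans im; rewrite le_eqVlt; apply/orP; left; apply/eqP.
by congr `|_|; rewrite !mxE /= mulr0 add0r; field.
Qed.

End OpticalExpansion.

(** * From power bounds to Landau notation and limits *)

Lemma pow_bound_eqO (R : realType) (J : set R) (c : R) n (f : R -> R)
    (F : filter_on R) :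
  F `=>` nbhs c -> (\forall x \near F, J x) -> pow_bound J c n f ->
  f =O_F (fun x => (x - c) ^+ n).
Proof.
(* The Landau constant must be positive, whereas [K] may be 0. *)
move=> Fc FJ [K K0 fK]; apply/eqO_exP; exists (K + 1); first by rewrite ltr_wpDl.
apply: filterS2 FJ (Fc _ fK) => x Jx /(_ Jx) fx.
by rewrite (le_trans fx)// normrX ler_wpM2r ?exprn_ge0// lerDl.
Qed.

Lemma pow_bound_quotient_cvg (R : realType) (J : set R) (c l : R) n f :
  interior J c -> pow_bound J c n.+1 (fun x => f x - (x - c) ^+ n * l) ->
  f x / (x - c) ^+ n @[x --> c^'] --> l.
Proof.
move=> Jc [K K0 fK]; apply/cvgrPdist_le => e e0.
have K1 : 0 < K + 1 by rewrite ltr_wpDl.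
have x1 : \forall x \near c, `|x - c| <= e / (K + 1).
  exists (e / (K + 1)) => /=; first exact: divr_gt0.
  by move=> x; rewrite /ball_/= distrC; exact: ltW.
rewrite /dnbhs near_withinE.
apply: filterS3 Jc fK x1 => x Jx /(_ Jx) fx x1 xc.
have xn0 : (x - c) ^+ n != 0 by rewrite expf_neq0// subr_eq0.
have -> : l - f x / (x - c) ^+ n = - ((f x - (x - c) ^+ n * l) / (x - c) ^+ n) by field.
rewrite normrN normrM normfV ler_pdivrMr ?normr_gt0// (le_trans fx)//.
rewrite exprS normrX mulrA ler_wpM2r ?exprn_ge0//.
rewrite (le_trans (ler_wpM2l K0 x1))// mulrA ler_pdivrMr// mulrC.
by rewrite ler_wpM2l ?ltW// ltrDl.
Qed.

(** In q - 1 = (sqrt q - 1)(sqrt q + 1) the second factor is at least 1. Thus a relative error of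
    the determinant bounds that of its root. *)
Lemma dist_sqrtr1 (R : realType) (q : R) : 0 <= q -> `|Num.sqrt q - 1| <= `|q - 1|.
Proof.
move=> q0; have s0 := sqrtr_ge0 q.
have -> : q - 1 = (Num.sqrt q - 1) * (Num.sqrt q + 1).
  by rewrite -subr_sqr sqr_sqrtr// expr1n.
by rewrite normrM ler_peMr// ger0_norm ?addr_ge0// lerDr.
Qed.

(** * The signed root of the determinant *)

Section WdetExpansion.
Variables (R : realType) (J : set R) (c : R) (T D D' : R -> 'M[R]_2).
Hypotheses (J_itv : is_interval J) (intJc : interior J c).
Hypothesis T_lip : mx_pow_bound J c 1 (fun x => T x - T c).
Hypothesis D_deriv : forall x, J x -> has_derivative_in J D x (D' x).
Hypothesis D'_deriv : forall x, J x -> has_derivative_in J D' x (T x *m D x).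
Hypothesis Dc : D c = 0.
Hypothesis d_neq0 : \det (D' c) != 0.

Let d := \det (D' c).
Let Jc : J c := nbhs_singleton intJc.
Let leading : pow_bound J c 4 (fun x => \det (D x) - (x - c) ^+ 2 * d) :=
  focus_det_leading J_itv Jc T_lip D_deriv D'_deriv Dc.
Let minorant : \forall x \near c, J x ->
    `|d| / 2 * `|x - c| ^+ 2 <= Num.sg d * \det (D x) :=
  focus_det_minorant J_itv Jc T_lip D_deriv D'_deriv Dc d_neq0.
Let sgr_det : \forall x \near c, J x -> x != c ->
    Num.sg (\det (D x)) = Num.sg d :=
  focus_sgr_det J_itv Jc T_lip D_deriv D'_deriv Dc d_neq0.

Let normd_gt0 : 0 < `|d|. Proof. by rewrite normr_gt0. Qed.

Lemma sgr_det_near : \forall x \near c, x != c -> Num.sg (\det (D x)) = Num.sg d.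
Proof. by apply: filterS2 intJc sgr_det => x Jx /(_ Jx). Qed.

(** With the sign of the determinant constant near the focus, the absolute value under the root
    becomes the smooth factor [Num.sg d * \det (D x)]. *)
Lemma wdet_near :
  \forall x \near c, x != c -> wdet D x = Num.sg d * Num.sqrt (Num.sg d * \det (D x)).
Proof.
apply: filterS sgr_det_near => x H /H {}H.
by rewrite /wdet normrEsg H.
Qed.

Lemma sgr_wdet_near : \forall x \near c, x != c -> Num.sg (wdet D x) = Num.sg d.
Proof.
apply: filterS sgr_det_near => x H /H {}H.
rewrite /wdet sgrM sgr_id H [Num.sg (Num.sqrt _)]gtr0_sg ?mulr1// sqrtr_gt0 normr_gt0.
by rewrite -sgr_eq0 H sgr_eq0.
Qed.

Lemma wdet_expansion : exists r : R -> R,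
  r =O_ (nbhs c) (fun x => (x - c) ^+ 2) /\
  \forall x \near c, wdet D x =
    Num.sg d * `|x - c| * Num.sqrt `|d| * (1 + r x).
Proof.
pose q x := Num.sg d * \det (D x) / (`|x - c| ^+ 2 * `|d|).
(* At [c] itself [q] is 0 by the convention for division by zero, and [Num.sqrt (q c) - 1] would be
   -1; the bound by [(x - c) ^+ 2] there forces the value 0. *)
exists (fun x => if x == c then 0 else Num.sqrt (q x) - 1); split.
  apply: (@pow_bound_eqO _ J) => //.
  have [K K0 HK] := leading; exists (K / `|d|); first by rewrite divr_ge0.
  apply: filterS2 HK minorant => x + + Jx => /(_ Jx) HK /(_ Jx) m.
  have [->|xc] := eqVneq x c; first by rewrite subrr normr0 expr0n mulr0.
  have xc0 : 0 < `|x - c| ^+ 2 by rewrite exprn_gt0// normr_gt0 subr_eq0.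
  have sd0 : 0 <= Num.sg d * \det (D x).
    by apply: le_trans m; rewrite mulr_ge0 ?divr_ge0 ?ltW.
  have q0 : 0 <= q x by rewrite divr_ge0// mulr_ge0 ?ltW.
  rewrite (le_trans (dist_sqrtr1 q0))//.
  have -> : q x - 1 = Num.sg d * (\det (D x) - (x - c) ^+ 2 * d) / (`|x - c| ^+ 2 * `|d|).
    rewrite /q mulrBr mulrCA -normrEsg -[(x - c) ^+ 2]real_normK ?num_real//.
    by rewrite mulrBl divff// mulf_neq0 ?gt_eqF.
  rewrite !normrM normr_sg d_neq0 mul1r normfV normrM !normrX !normr_id.
  have dxc : 0 < `|x - c| ^+ 2 * `|d| by exact: mulr_gt0.
  rewrite (ler_pdivrMr _ _ dxc); apply: (le_trans HK).
  have -> : K / `|d| * `|x - c| ^+ 2 * (`|x - c| ^+ 2 * `|d|) = K * `|x - c| ^+ 4.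
    by field; rewrite gt_eqF.
  by [].
apply: filterS3 wdet_near minorant intJc => x w m Jx.
case: eqVneq => [->|xc].
  by rewrite subrr normr0 mulr0 !mul0r /wdet Dc det0 sgr0 mul0r.
rewrite w// [1 + _]addrC subrK -!mulrA; congr (_ * _).
have xc0 : 0 < `|x - c| by rewrite normr_gt0 subr_eq0.
have -> : `|x - c| = Num.sqrt (`|x - c| ^+ 2) by rewrite sqrtr_sqr normr_id.
rewrite -!sqrtrM ?exprn_ge0//; congr Num.sqrt.
by rewrite /q; field; rewrite !gt_eqF.
Qed.

(** From det D = O(e^2) one gets |w| <= sqrt K |e|, while w(c) = 0. *)
Lemma wdet_continuous : {for c, continuous (wdet D)}.
Proof.
suff H : wdet D @ within J (nbhs c) --> wdet D c.
  by move=> A /H HA; apply: filterS2 intJc HA => x Jx; exact.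
apply: pow_bound_cvg.
have [K K0 HK] : pow_bound J c 2 (fun x => \det (D x)).
  have := pow_boundD (pow_boundW (n := 4) (m := 2) isT leading)
    (pow_boundM (pow_boundXB J c 2) (pow_bound_cst J c d)).
  by apply: pow_bound_eq => x _; rewrite subrK.
exists (Num.sqrt K); first exact: sqrtr_ge0.
apply: filterS HK => x + Jx => /(_ Jx) {}HK.
rewrite {2}/wdet Dc det0 sgr0 mul0r subr0 normrM [`|Num.sqrt _|]ger0_norm ?sqrtr_ge0//.
apply: (@le_trans _ _ (Num.sqrt `|\det (D x)|)).
  by rewrite ler_piMl ?sqrtr_ge0// normr_sg; case: (_ != 0).
have -> : Num.sqrt K * `|x - c| ^+ 1 = Num.sqrt (K * `|x - c| ^+ 2).
  by rewrite sqrtrM// sqrtr_sqr normr_id.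
exact: ler_wsqrtr.
Qed.

(** This is tr(adj(D) D'), the derivative of the determinant by Jacobi's formula. *)
Let delta x := D' x 0 0 * D x 1 1 + D x 0 0 * D' x 1 1 -
  (D' x 0 1 * D x 1 0 + D x 0 1 * D' x 1 0).

Lemma diff_on_det : diff_on J (fun x => \det (D x)) delta.
Proof.
have dD := has_derivative_in_mx_diff_on D_deriv.
apply: diff_on_eq (diff_onB (diff_onM (dD 0 0) (dD 1 1))
  (diff_onM (dD 0 1) (dD 1 0))) => x //.
by rewrite det_mx2.
Qed.

Lemma wdet_is_derive : \forall x \near c, x != c ->
  is_derive x 1 (wdet D) (delta x / (2 * Num.sqrt (Num.sg d * \det (D x)))).
Proof.
(* The formula for w must hold on a whole neighbourhood of [x] for its derivative at [x] to be that
   of w. *)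
have := nbhs_interior intJc; have := nbhs_interior wdet_near.
have := minorant; apply: filterS3 => x m w Jx xc.
have {}m := m (nbhs_singleton Jx).
have det0 : 0 < Num.sg d * \det (D x).
  by apply: lt_le_trans m; rewrite mulr_gt0 ?divr_gt0 ?exprn_gt0 ?normr_gt0 ?subr_eq0.
have dd := diff_on_det.2 x Jx.
have dsd : is_derive x 1 (fun y => Num.sg d * \det (D y)) (Num.sg d * delta x).
  exact: (is_deriveZ (Num.sg d) dd).
have ds := @is_derive1_comp R Num.sqrt (fun y => Num.sg d * \det (D y)) x _ _
  (is_derive1_sqrt det0) dsd.
have dw : is_derive x 1 (fun y => Num.sg d * Num.sqrt (Num.sg d * \det (D y)))
    (Num.sg d * ((2 * Num.sqrt (Num.sg d * \det (D x)))^-1 * (Num.sg d * delta x))).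
  exact: (is_deriveZ (Num.sg d) ds).
have H : \forall y \near x, Num.sg d * Num.sqrt (Num.sg d * \det (D y)) = wdet D y.
  have xc' : \forall y \near x, y != c.
    by exact: (open_nbhs_nbhs (conj (@open_neq R c) xc)).
  by apply: filterS2 w xc' => y wy /wy ->.
have {}dw := near_eq_is_derive H dw; apply: (is_derive_eq dw).
have sd2 : Num.sg d * Num.sg d = 1 by rewrite -expr2 sqr_sg d_neq0.
by rewrite mulrCA (mulrA (Num.sg d)) sd2 mul1r mulrC.
Qed.

(** Each product of an entry of D' with one of D is e times the product of the corresponding entries
    of P, up to O(e^2); the four products add up to 2 e det P. *)
Lemma delta_cvg : delta x / (x - c) ^+ 1 @[x --> c^'] --> 2 * d.
Proof.
apply: (@pow_bound_quotient_cvg _ J) => //.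
have a2 := mx_pow_boundW (leqnSn 1) (focus_deriv_O2 J_itv Jc T_lip D_deriv D'_deriv Dc).
have b3 := mx_pow_boundW (leqnSn 2) (focus_O3 J_itv Jc T_lip D_deriv D'_deriv Dc).
have O1 := focus_O1 Jc D_deriv Dc.
have O0 := mx_pow_bound_cst J c (D' c).
have H i j k l : pow_bound J c 2 (fun x =>
    D' x i j * D x k l - (x - c) * (D' c i j * D' c k l)).
  have := pow_boundD (pow_boundM (a2 i j) (O1 k l)) (pow_boundM (O0 i j) (b3 k l)).
  by apply: pow_bound_eq => x _; rewrite !mxE; ring.
have := pow_boundB (pow_boundD (H 0 0 1 1) (H 1 1 0 0))
  (pow_boundD (H 0 1 1 0) (H 1 0 0 1)).
by apply: pow_bound_eq => x _; rewrite /delta /d det_mx2; ring.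
Qed.

Lemma abs_det_cvg : Num.sg d * \det (D x) / (x - c) ^+ 2 @[x --> c^'] --> `|d|.
Proof.
apply: (@pow_bound_quotient_cvg _ J) => //.
have := pow_boundM (pow_bound_cst J c (Num.sg d)) (pow_boundW (leqnSn 3) leading).
by apply: pow_bound_eq => x _; rewrite normrEsg; ring.
Qed.

(** Dividing numerator and root by their orders in e leaves a quotient with a two-sided limit. It
    differs from the derivative of w by the factor sg(e), the source of the jump. *)
Lemma wdet_derive_quotient_cvg :
  delta x / (x - c) ^+ 1 / (2 * Num.sqrt (Num.sg d * \det (D x) / (x - c) ^+ 2))
    @[x --> c^'] --> d / Num.sqrt `|d|.
Proof.
have -> : d / Num.sqrt `|d| = 2 * d / (2 * Num.sqrt `|d|).
  by field; rewrite gt_eqF// sqrtr_gt0.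
apply: cvgM; first exact: delta_cvg.
apply: cvgV; first by rewrite mulf_neq0// gt_eqF// sqrtr_gt0.
apply: cvgM; first exact: cvg_cst.
exact: cvg_comp abs_det_cvg (@sqrt_continuous R _).
Qed.

Lemma sqrtr_div_sqr (y : R) (e : R) : 0 <= y -> Num.sqrt (y / e ^+ 2) = Num.sqrt y / `|e|.
Proof. by move=> y0; rewrite sqrtrM// sqrtrV ?sqr_ge0// sqrtr_sqr. Qed.

Lemma wdet_derive1 : \forall x \near c, x != c -> derive1 (wdet D) x =
  Num.sg (x - c) * (delta x / (x - c) ^+ 1 /
    (2 * Num.sqrt (Num.sg d * \det (D x) / (x - c) ^+ 2))).
Proof.
apply: filterS3 intJc minorant wdet_is_derive => x Jx /(_ Jx) m H xc.
have := H xc => {}H; rewrite derive1E derive_val.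
have det0 : 0 < Num.sg d * \det (D x).
  by apply: lt_le_trans m; rewrite mulr_gt0 ?divr_gt0 ?exprn_gt0 ?normr_gt0 ?subr_eq0.
rewrite sqrtr_div_sqr ?ltW// normrEsg.
have xc0 : x - c != 0 by rewrite subr_eq0.
have s0 : Num.sg (x - c) != 0 by rewrite sgr_eq0.
have s2 : Num.sg (x - c) ^+ 2 = 1 by rewrite sqr_sg xc0.
have q0 : Num.sqrt (Num.sg d * \det (D x)) != 0 by rewrite gt_eqF// sqrtr_gt0.
(* Inserting sg(e)^2 = 1 on the left makes the identity a rational one in sg(e), since |e| = sg(e)
   e. *)
rewrite -[LHS]mul1r -[X in X * _ = _]s2.
by field; rewrite xc0 s0 q0.
Qed.

Lemma wdet_derive1_right : derive1 (wdet D) x @[x --> c^'+] --> d / Num.sqrt `|d|.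
Proof.
move=> A /wdet_derive_quotient_cvg HA; apply: filterS2 wdet_derive1 HA => x + + cx.
have xc : x != c by rewrite gt_eqF.
by move=> /(_ xc) E /(_ xc); rewrite /= E [Num.sg (x - c)]gtr0_sg ?subr_gt0// mul1r.
Qed.

Lemma wdet_derive1_left : derive1 (wdet D) x @[x --> c^'-] --> - (d / Num.sqrt `|d|).
Proof.
move=> A /(cvgN wdet_derive_quotient_cvg) HA; apply: filterS2 wdet_derive1 HA => x + + cx.
have xc : x != c by rewrite lt_eqF.
by move=> /(_ xc) E /(_ xc); rewrite /= E [Num.sg (x - c)]ltr0_sg ?subr_lt0// mulN1r.
Qed.

End WdetExpansion.

(** * Regularity of T and proof of the theorem *)

Lemma class_C_deriv (R : realType) (J : set R) k (T : R -> 'M[R]_2) :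
  (0 < k)%N -> class_C k J T ->
  (forall c, J c -> mx_pow_bound J c 1 (fun x => T x - T c)) /\
  (forall i j, {within J, continuous (fun x => T x i j)}).
Proof.
move=> k0 [g [g0 gd _]].
have lip c : J c -> mx_pow_bound J c 1 (fun x => T x - T c).
  move=> Jc; have := has_derivative_in_mx_pow_bound (gd 0%N c k0 Jc).
  by apply: mx_pow_bound_eq => x Jx; rewrite !g0.
split=> // i j; apply/subspace_continuousP => x Jx; apply: pow_bound_cvg.
by apply: pow_bound_eq (lip x Jx i j) => y _; rewrite !mxE.
Qed.

Theorem mainTheorem2 (R : realType) (J : set R) (k : nat)
    (T D D' : R -> 'M[R]_2)
    (J_itv : is_interval J) (J0 : J 0) (J_ge0 : forall x, J x -> 0 <= x)
    (J_nondeg : exists b, J b /\ 0 < b)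
    (k_ge2 : (2 <= k)%N)
    (T_sym : forall x, J x -> (T x)^T = T x)
    (T_Ck : class_C k J T)
    (D_deriv : forall x, J x -> has_derivative_in J D x (D' x))
    (D'_deriv : forall x, J x -> has_derivative_in J D' x (T x *m D x))
    (D_init : D 0 = 0) (D'_init : D' 0 = 1%:M) :
  [/\ (* the deformation matrix is parametrized by theta and sigma *)
      forall x, J x -> D x \in unitmx ->
        deformation D D' x = optical_mx (theta D D' x) (sigma D D' x),
      (* expansions at a focus *)
      forall c : R, 0 < c -> interior J c -> D c = 0 ->
        let Rc := scalar_part (T c) in
        let Fc := shear_part (T c) in
        let d := \det (D' c) in
        [/\ d != 0,
            (fun x => \det (D x)
               - (x - c) ^+ 2 * (1 + (x - c) ^+ 2 / 3 * Rc) * d)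
              =O_ (nbhs c) (fun x => (x - c) ^+ 5),
            [/\ \forall x \near c^', D x \in unitmx,
                (fun x => theta D D' x
                   - (x - c)^-1 * (1 + 3^-1 * Rc * (x - c) ^+ 2))
                  =O_ (c^') (fun x => (x - c) ^+ 2)
              & (fun x => cmod (sigma D D' x - (3^-1 * (x - c))%:C * Fc))
                  =O_ (c^') (fun x => (x - c) ^+ 2)],
            exists r : R -> R,
              r =O_ (nbhs c) (fun x => (x - c) ^+ 2) /\
              \forall x \near c, wdet D x =
                Num.sg d * `|x - c| * Num.sqrt `|d| * (1 + r x)
          & [/\ {for c, continuous (wdet D)},
                exists s : R, [/\ s != 0,
                  \forall x \near c^'-, Num.sg (wdet D x) = s
                  & \forall x \near c^'+, Num.sg (wdet D x) = s]
              & (\forall x \near c^', derivable (wdet D) x 1) /\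
                exists a b : R, [/\ a != b,
                  derive1 (wdet D) x @[x --> c^'-] --> a
                  & derive1 (wdet D) x @[x --> c^'+] --> b]]]
      (* expansions at the vertex *)
    & [/\ \forall x \near 0^'+, D x \in unitmx,
          (fun x => theta D D' x
             - x^-1 * (1 + 3^-1 * scalar_part (T 0) * x ^+ 2))
            =O_ (0^'+) (fun x => x ^+ 2)
        & (fun x => cmod (sigma D D' x - (3^-1 * x)%:C * shear_part (T 0)))
            =O_ (0^'+) (fun x => x ^+ 2)]].

Proof.
have [T_lip T_cont] := class_C_deriv (ltnW k_ge2) T_Ck.
have dD := has_derivative_in_mx_diff_on D_deriv.
have dD' := has_derivative_in_mx_diff_on D'_deriv.
split.
- exact: (deformation_sym J_itv J0 J_ge0 T_sym dD dD' D_init).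
- move=> c c0 intJc Dc Rc Fc d.
  have Jc := nbhs_singleton intJc.
  have d0 : d != 0 by exact: (focus_det_neq0 J_itv J0 Jc c0 T_cont dD dD' D'_init Dc).
  have dnb : c^' `=>` nbhs c by move=> A; apply: filterS => x Ax _; exact: Ax.
  have Jc' : \forall x \near c^', (J `\ c) x.
    by rewrite /dnbhs near_withinE; apply: filterS intJc => x Jx /eqP xc; split.
  split.
  + exact: d0.
  + apply: (pow_bound_eqO _ intJc) => //.
    exact: (focus_det_expansion J_itv Jc (T_lip c Jc) D_deriv D'_deriv Dc).
  + split.
    * rewrite /dnbhs near_withinE.
      have := focus_unitmx J_itv Jc (T_lip c Jc) D_deriv D'_deriv Dc d0.
      by apply: filterS2 intJc => x Jx /(_ Jx).
    * apply: (pow_bound_eqO dnb Jc').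
      exact: (focus_theta_expansion J_itv Jc (T_lip c Jc) D_deriv D'_deriv Dc d0).
    * apply: (pow_bound_eqO dnb Jc').
      exact: (focus_sigma_expansion J_itv Jc (T_lip c Jc) D_deriv D'_deriv Dc d0).
  + exact: (wdet_expansion J_itv intJc (T_lip c Jc) D_deriv D'_deriv Dc d0).
  + have sgw := sgr_wdet_near J_itv intJc (T_lip c Jc) D_deriv D'_deriv Dc d0.
    split.
    * exact: (wdet_continuous J_itv intJc (T_lip c Jc) D_deriv D'_deriv Dc).
    * exists (Num.sg d); split; first by rewrite sgr_eq0.
        rewrite /at_left near_withinE; apply: filterS sgw => x H xc.
        by rewrite H// lt_eqF.
      rewrite /at_right near_withinE; apply: filterS sgw => x H xc.
      by rewrite H// gt_eqF.
    * split.
        rewrite /dnbhs near_withinE.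
        have := wdet_is_derive J_itv intJc (T_lip c Jc) D_deriv D'_deriv Dc d0.
        by apply: filterS => x H /H [].
      (* The one-sided limits of the derivative are opposite, and they differ because [d] is
         nonzero. *)
      exists (- (d / Num.sqrt `|d|)), (d / Num.sqrt `|d|); split.
      - rewrite eq_sym -subr_eq0 opprK -mulr2n mulrn_eq0/= mulf_neq0//.
        by rewrite invr_eq0 gt_eqF// sqrtr_gt0 normr_gt0.
      - exact: (wdet_derive1_left J_itv intJc (T_lip c Jc) D_deriv D'_deriv Dc d0).
      - exact: (wdet_derive1_right J_itv intJc (T_lip c Jc) D_deriv D'_deriv Dc d0).
(* At the vertex D'(0) = I gives determinant 1, and the expansions proved for a point of [J] apply
   with c = 0. *)
- have d0 : \det (D' 0) != 0 by rewrite D'_init det1 oner_neq0.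
  have dnb : (0:R)^'+ `=>` nbhs 0 by move=> A; apply: filterS => x Ax _; exact: Ax.
  have J0' : \forall x \near (0:R)^'+, (J `\ 0) x.
    (* A positive point [b] of [J] places the right neighbourhood ]0, b[ inside [J]. *)
    have [b [Jb b0]] := J_nondeg.
    rewrite /at_right near_withinE; apply: filterS (lt_nbhsl b0) => x xb x0.
    by split; [apply: J_itv J0 Jb _ _; rewrite !ltW|move/eqP; rewrite gt_eqF].
  have eqO0 (f : R -> R) : pow_bound (J `\ 0) 0 2 f -> f =O_ (0^'+) (fun x => x ^+ 2).
    move=> /(pow_bound_eqO dnb J0').
    by have -> : (fun x : R => (x - 0) ^+ 2) = (fun x => x ^+ 2)
      by apply/funext => x; rewrite subr0.
  split.
  + have := focus_unitmx J_itv J0 (T_lip 0 J0) D_deriv D'_deriv D_init d0.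
    move=> /dnb; apply: filterS2 J0' => x [Jx /eqP x0] H; exact: H.
  + apply: eqO0.
    have := focus_theta_expansion J_itv J0 (T_lip 0 J0) D_deriv D'_deriv D_init d0.
    by apply: pow_bound_eq => x _; rewrite subr0.
  + apply: eqO0.
    have := focus_sigma_expansion J_itv J0 (T_lip 0 J0) D_deriv D'_deriv D_init d0.
    by apply: pow_bound_eq => x _; rewrite subr0.
Qed.
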